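(* Let $n\ge 3$. The $S$-algebra $(\mathbb{C}\langle u,v\rangle^{D_{2n}},\circ)$ is generated as an $S$-algebra by the two elements $uv+vu$ and $u^n+v^n$; that is, the smallest $S$-subalgebra of $\mathbb{C}\langle u,v\rangle$ containing $uv+vu$ and $u^n+v^n$ equals $\mathbb{C}\langle u,v\rangle^{D_{2n}}$.
   Context: $\mathbb{C}\langle u,v\rangle$ is the free associative unital algebra over $\mathbb C$ on noncommuting $u,v$; $\mathbb{C}\langle u,v\rangle^{(k)}$ is its homogeneous component of total degree $k$. The dihedral group $D_{2n}=\langle\rho,\tau\mid \rho^n=\tau^2=(\tau\rho)^2=1\rangle$ acts on $\mathbb{C}\langle u,v\rangle$ by algebra automorphisms determined by $\rho(u)=\xi u$, $\rho(v)=\xi^{-1}v$, $\tau(u)=v$, $\tau(v)=u$, $\xi=e^{2\pi i/n}$, and $\mathbb{C}\langle u,v\rangle^{D_{2n}}$ is the algebra of fixed points. (Koryukin's position action) For each $k$, the symmetric group $\mathrm{Sym}(k)$ acts on $\mathbb{C}\langle u,v\rangle^{(k)}$ from the right by permuting positions: for a monomial $x_{i_1}\cdots x_{i_k}$ with $x_{i_j}\in\{u,v\}$ and $\pi\in\mathrm{Sym}(k)$, $(x_{i_1}\cdots x_{i_k})\circ\pi=x_{i_{\pi^{-1}(1)}}\cdots x_{i_{\pi^{-1}(k)}}$, extended linearly. An $S$-subalgebra is a graded (unital) subalgebra $F=\bigoplus_k F^{(k)}$ of $\mathbb{C}\langle u,v\rangle$ with $F^{(k)}\circ\mathrm{Sym}(k)=F^{(k)}$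 for all $k$; the $S$-subalgebra generated by a set of homogeneous elements is the smallest $S$-subalgebra containing it. *)

(* Defs.v *)
From mathcomp Require Import all_boot all_order all_algebra all_fingroup all_field.
From mathcomp Require Import complex.
From mathcomp Require Import Rstruct.
Set Implicit Arguments. Unset Strict Implicit. Unset Printing Implicit Defensive.
Import Order.TTheory GRing.Theory Num.Theory.
Local Open Scope ring_scope.

Definition C : numClosedFieldType := (Rdefinitions.R[i])%C.

(* The free associative unital algebra C<u,v> over C.  A word in u,v is a [seq bool], with
   false = u and true = v.  An element of the algebra of noncommutative
   formal series is a coefficient function [word -> C]; the free algebra
   C<u,v> consists of those with finite support ([is_poly]). *)
Definition word := seq bool.
Definition fa := word -> C.

Definition fa_zero : fa := fun _ => 0.
Definition fa_one : fa := fun w => (w == [::])%:R.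
Definition fa_add (f g : fa) : fa := fun w => f w + g w.
Definition fa_scale (c : C) (f : fa) : fa := fun w => c * f w.
Definition fa_mul (f g : fa) : fa :=
  fun w => \sum_(i < (size w).+1) f (take i w) * g (drop i w).
Definition fa_pow (f : fa) (m : nat) : fa := iter m (fa_mul f) fa_one.
Definition fa_var (b : bool) : fa := fun w => (w == [:: b])%:R.
Definition fa_u : fa := fa_var false.
Definition fa_v : fa := fa_var true.

Definition is_poly (f : fa) : Prop :=
  exists N : nat, forall w : word, (N <= size w)%N -> f w = 0.

Definition hcomp (k : nat) (f : fa) : fa := fun w => if size w == k then f w else 0.
Definition homog (k : nat) (f : fa) : Prop := forall w : word, size w != k -> f w = 0.

(* Koryukin's position action of pi in Sym(k) on degree-k elements:
   (x_{i_1}...x_{i_k}) o pi = x_{i_{pi^-1(1)}} ... x_{i_{pi^-1(k)}},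
   so the coefficient of w' in f o pi is the coefficient of
   [w'_{pi(1)}, ..., w'_{pi(k)}] in f. *)
Definition posact (k : nat) (s : 'S_k) (f : fa) : fa :=
  fun w => if size w == k then f [seq nth false w (s i) | i <- enum 'I_k] else 0.

Definition is_S_subalgebra (F : fa -> Prop) : Prop :=
  (forall f, F f -> is_poly f) /\
  F fa_zero /\ F fa_one /\
  (forall f g, F f -> F g -> F (fa_add f g)) /\
  (forall c f, F f -> F (fa_scale c f)) /\
  (forall f g, F f -> F g -> F (fa_mul f g)) /\
  (forall k f, F f -> F (hcomp k f)) /\
  (forall k (s : 'S_k) f, F f -> homog k f -> F (posact s f)).

Definition S_generated (G : fa -> Prop) (f : fa) : Prop :=
  forall F : fa -> Prop, is_S_subalgebra F -> (forall g, G g -> F g) -> F f.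

(* xi = e^{2 pi i / n}: n.-root (-1) is the n-th root of -1 of minimal
   nonnegative argument, i.e. e^{i pi / n}; its square is e^{2 pi i/n}. *)
Definition xi (n : nat) : C := (n.-root (-1 : C)) ^+ 2.

(* rho(u) = xi u, rho(v) = xi^-1 v: acts on the monomial w by the scalar
   xi^{#u(w)} (xi^-1)^{#v(w)} *)
Definition rho_act (n : nat) (f : fa) : fa :=
  fun w => xi n ^+ count negb w * (xi n)^-1 ^+ count id w * f w.
Definition tau_act (f : fa) : fa := fun w => f (map negb w).

Definition dih_act (n k : nat) (e : bool) (f : fa) : fa :=
  iter k (rho_act n) (if e then tau_act f else f).

Definition dih_invariant (n : nat) (f : fa) : Prop :=
  is_poly f /\ forall (k : nat) (e : bool), dih_act n k e f = f.

Definition gen1 : fa := fa_add (fa_mul fa_u fa_v) (fa_mul fa_v fa_u).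
Definition gen2 (n : nat) : fa := fa_add (fa_pow fa_u n) (fa_pow fa_v n).

(* Main.v *)
Require Import Defs.
From mathcomp Require Import all_boot all_order all_algebra all_fingroup all_field.
From mathcomp Require Import all_solvable ring.
From Stdlib Require Import FunctionalExtensionality.
Set Implicit Arguments. Unset Strict Implicit. Unset Printing Implicit Defensive.
Import Order.TTheory GRing.Theory Num.Theory.
Local Open Scope ring_scope.

(** For a word [w] let [P w] be the sum of [w] and the word obtained from it by
    exchanging u and v.  The invariants are spanned by the [P w] with [w] balanced,
    i.e. with #u(w) = #v(w) mod n, and every balanced [P w] is obtained by
    induction on the length of [w].  Here [P w * P w' = P (w w') + P (w (tau w'))].
    If [w] has both letters and length at least 3, removing one u and one v gives a
    shorter balanced word [w']; [gen1 * P w'] and the position action give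
    [P x = - P y] modulo the subalgebra when [x] and [y] differ by a transposition
    of two different letters, and three such transpositions compose to
    [P w = - P w].  If [w] is the power u^(m+n), with n dividing m > 0, then
    [P (u^m) * gen2 = P (u^(m+n)) + P (u^m v^n)], where the last word is mixed.
    That [xi n] is a primitive n-th root of unity is extracted from the extremal
    property characterising [n.-root]. *)

(** * Primitivity of the root of unity [xi n] *)

(** In characteristic 0 the polynomial X^n - 1 is separable, so it has n distinct roots, and n
    distinct n-th roots of unity include a primitive one. *)
Lemma closed_prim_root_exists (K : numClosedFieldType) (n : nat) :
  (0 < n)%N -> exists z : K, n.-primitive_root z.
Proof.
move=> n_gt0; have [r Dp] := closed_field_poly_normal ('X^n - 1 : {poly K}).
have monXn1 : 'X^n - 1 \is @monic K by rewrite monicE lead_coefXnsubC.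
move: Dp; rewrite (monicP monXn1) scale1r => Dp.
have: has n.-primitive_root r.
  apply: has_prim_root => //.
  - apply/allP => z; rewrite -root_prod_XsubC -Dp => rz.
    by rewrite unity_rootE -subr_eq0; move: rz; rewrite rootE !hornerE.
  - rewrite -separable_prod_XsubC -Dp.
    by apply: separable_Xn_sub_1; rewrite pnatr_eq0 -lt0n.
  by rewrite -ltnS -(size_prod_XsubC _ id) -Dp size_XnsubC.
by case/hasP => z _ prz; exists z.
Qed.

Lemma norm_exprN1 (K : numClosedFieldType) (n : nat) (z : K) :
  (0 < n)%N -> z ^+ n = -1 -> `|z| = 1.
Proof.
move=> n_gt0 zn; apply/eqP; rewrite -(@pexpr_eq1 _ _ n) // -normrX zn normrN.
by rewrite normr1.
Qed.

(** If the root were real it would be nonnegative of norm 1, hence equal to 1, whose powers are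
    never -1. *)
Lemma Im_rootCN1_gt0 (K : numClosedFieldType) (n : nat) :
  (1 < n)%N -> 0 < 'Im (n.-root (-1 : K)).
Proof.
move=> n_gt1; have n_gt0 := ltnW n_gt1; set z := n.-root _.
have zn : z ^+ n = -1 by rewrite /z rootCK.
rewrite lt_def Im_rootC_ge0 // andbT; apply/eqP => /Creal_ImP z_real.
have : `|z| = 1 by apply: (norm_exprN1 n_gt0).
have [z_ge0|z_lt0] := real_ge0P z_real; last by move: z_lt0; rewrite rootC_lt0.
move=> z1; move: (ltrN10 K); rewrite -zn z1 expr1n.
by rewrite ltr10.
Qed.

(** The library's extremal property concerns roots in the closed upper half plane; any other root is
    conjugate to one of these, with the same real part. *)
Lemma Re_le_rootCN1 (K : numClosedFieldType) (n : nat) (y : K) :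
  (0 < n)%N -> y ^+ n = -1 -> 'Re y <= 'Re (n.-root (-1 : K)).
Proof.
move=> n_gt0 yn; have [Iy|Iy] := real_ge0P (Creal_Im y).
  exact: rootC_Re_max.
rewrite -Re_conj; apply: rootC_Re_max => //; last by rewrite Im_conj oppr_ge0 ltW.
by rewrite -rmorphXn /= yn rmorphN1.
Qed.

(** For unit [w] and [z] of arguments a and b this is cos a - cos (a + 2b) = 2 sin b sin (a + b). It
    turns maximality of a real part into a sign condition. *)
Lemma Re_sub_mul_sqr (K : numClosedFieldType) (w z : K) : `|z| = 1 ->
  'Re w - 'Re (w * z ^+ 2) = 2 * 'Im z * ('Re w * 'Im z + 'Im w * 'Re z).
Proof.
move=> z1; have := normC2_Re_Im z; rewrite z1 expr1n => cs1.
by rewrite expr2 !ReM !ImM -[in LHS](mulr1 ('Re w)) [X in _ * X - _]cs1; ring.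
Qed.

(* Writing [w] and [z] as unit vectors of arguments alpha and beta, with
   [0 < beta < pi], the two extremality hypotheses say |alpha| <= beta,
   while [Re w <= Re z] says |alpha| >= beta. *)
Lemma Re_unit_extremal (K : numClosedFieldType) (w z : K) :
  `|w| = 1 -> `|z| = 1 -> 0 < 'Im z -> 'Re w <= 'Re z ->
  'Re (w * z ^+ 2) <= 'Re w -> 'Re (w * z^-1 ^+ 2) <= 'Re w ->
  w = z \/ w = z^-1.
Proof.
move=> w1 z1 s_gt0 le_wz.
have zC : z^-1 = z^* by rewrite invC_norm z1 expr1n invr1 mul1r.
have z1' : `|z^*| = 1 by rewrite norm_conjC.
rewrite zC -subr_ge0 Re_sub_mul_sqr // pmulr_rge0 ?mulr_gt0 ?ltr0n // => le1.
rewrite -subr_ge0 Re_sub_mul_sqr // Re_conj Im_conj !mulrN mulNr -mulrN opprD opprK.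
rewrite pmulr_rge0 ?mulr_gt0 ?ltr0n // => le2.
have Rw_ge0 : 0 <= 'Re w.
  have := addr_ge0 le1 le2; rewrite addrACA subrr addr0 -mulr2n pmulrn_lge0 //.
  by rewrite pmulr_lge0.
have w2 := normC2_Re_Im w; have z2 := normC2_Re_Im z.
rewrite w1 z1 expr1n in w2 z2.
(* The product of the two sign conditions: sin (b + a) sin (b - a) = cos^2 a - cos^2 b. *)
have le3 : 'Re z ^+ 2 <= 'Re w ^+ 2.
  rewrite -subr_ge0; have := mulr_ge0 le1 le2.
  suff -> : ('Re w * 'Im z + 'Im w * 'Re z) * ('Re w * 'Im z - 'Im w * 'Re z) =
     'Re w ^+ 2 - 'Re z ^+ 2 by [].
  have -> : 'Re w ^+ 2 - 'Re z ^+ 2 = 'Re w ^+ 2 * ('Re z ^+ 2 + 'Im z ^+ 2)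
      - 'Re z ^+ 2 * ('Re w ^+ 2 + 'Im w ^+ 2) by rewrite -w2 -z2 !mulr1.
  by ring.
have Rz_ge0 := le_trans Rw_ge0 le_wz.
have eqRe : 'Re w = 'Re z.
  by apply/le_anti; rewrite le_wz /= -(@ler_pXn2r _ 2) ?nnegrE.
have : 'Im w ^+ 2 = 'Im z ^+ 2 by apply: (addrI ('Re w ^+ 2)); rewrite -w2 eqRe.
move/eqP; rewrite eqf_sqr => /orP[/eqP eqIm|/eqP eqIm].
  by left; apply/eqCP.
by right; apply/eqCP; rewrite Re_conj Im_conj.
Qed.

(* [Re_unit_extremal] is applied to an element of maximal real part among the
   [y * z ^+ (2 * i)], where [z = n.-root (-1)]. *)
Lemma rootCN1_generates (K : numClosedFieldType) (n : nat) (y : K) :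
  (1 < n)%N -> y ^+ n = -1 -> exists i, y = (n.-root (-1 : K)) ^ i.
Proof.
move=> n_gt1 yn; have n_gt0 := ltnW n_gt1; set z := n.-root _.
have zn : z ^+ n = -1 by rewrite /z rootCK.
have z1 : `|z| = 1 by apply: (norm_exprN1 n_gt0).
have z0 : z != 0 by rewrite -normr_eq0 z1 oner_eq0.
have z2n : (z ^+ 2) ^+ n = 1 by rewrite exprAC zn sqrrN expr1n.
pose F (i : 'I_n) := 'Re (y * (z ^+ 2) ^+ i).
have F_real : {in predT, forall i, F i \is Num.real} by move=> i _; exact: Creal_Re.
case: (@real_arg_maxP _ _ (Ordinal n_gt0) predT F isT F_real) => i _ imax.
have {}imax k : 'Re (y * (z ^+ 2) ^+ k) <= 'Re (y * (z ^+ 2) ^+ i).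
  by have := imax (Ordinal (ltn_pmod k n_gt0)) isT; rewrite /F /= expr_mod.
set w := y * (z ^+ 2) ^+ i in imax.
have wn : w ^+ n = -1 by rewrite exprMn yn (exprAC (z ^+ 2)) z2n expr1n mulr1.
have w1 : `|w| = 1 by apply: (norm_exprN1 n_gt0).
have y_w : y = w * z ^ (- (2 * i)%:Z).
  by rewrite -exprnN /w -exprM mulfK // expf_neq0.
have le1 : 'Re (w * z ^+ 2) <= 'Re w.
  by rewrite -mulrA -exprSr; exact: imax.
have le2 : 'Re (w * z^-1 ^+ 2) <= 'Re w.
  (* As [z ^+ 2] has n-th power 1, its inverse is its power of exponent n - 1, so this element is
     again in the family over which [w] is maximal. *)
  have -> : w * z^-1 ^+ 2 = y * (z ^+ 2) ^+ (i + n.-1).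
    rewrite exprD mulrA -/w; congr (_ * _).
    apply: (mulIf (expf_neq0 2 z0)); rewrite exprVn mulVf ?expf_neq0 //.
    by rewrite -exprSr prednK.
  exact: imax.
have [wz|wz] := Re_unit_extremal w1 z1 (Im_rootCN1_gt0 K n_gt1)
  (Re_le_rootCN1 n_gt0 wn) le1 le2.
  by rewrite y_w wz -{1}[z]expr1z -expfzDr //; eexists.
by rewrite y_w wz -exprN1 -expfzDr //; eexists.
Qed.

(** A primitive 2n-th root of unity [y] satisfies y^n = -1, so it is a power of [z]; hence its order
    2n divides the order of [z], which in turn divides 2n. *)
Lemma rootCN1_prim (K : numClosedFieldType) (n : nat) :
  (1 < n)%N -> (n * 2).-primitive_root (n.-root (-1 : K)).
Proof.
move=> n_gt1; have n_gt0 := ltnW n_gt1; set z := n.-root _.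
have n2_gt0 : (0 < n * 2)%N by rewrite muln_gt0 n_gt0.
have zn : z ^+ n = -1 by rewrite /z rootCK.
have [y py] := closed_prim_root_exists K n2_gt0.
have yn : y ^+ n = -1.
  have : (y ^+ n) ^+ 2 == 1 by rewrite -exprM prim_expr_order.
  rewrite sqrf_eq1 -(prim_order_dvd py) => /orP[|/eqP//].
  by move/(dvdn_leq n_gt0); rewrite leqNgt ltn_Pmulr.
have [i Dy] := rootCN1_generates n_gt1 yn.
have [m pm dvd_m] : {m | m.-primitive_root z & (m %| n * 2)%N}.
  by apply: prim_order_exists => //; rewrite exprM zn sqrrN expr1n.
suff -> : (n * 2)%N = m by [].
apply/eqP; rewrite eqn_dvd dvd_m andbT (prim_order_dvd py) Dy.
by rewrite exprnP exprzAC -exprnP (prim_expr_order pm) exp1rz.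
Qed.

Lemma xi_prim (n : nat) : (1 < n)%N -> n.-primitive_root (xi n).
Proof.
move=> n_gt1; have := exp_prim_root (rootCN1_prim C n_gt1) 2.
by rewrite gcdnMl mulnK.
Qed.

(** * Balanced words, and invariance read off coefficients *)

(** Since rho scales [w] by [xi n] to the power #u(w) - #v(w), these are the words fixed by rho once
    [xi n] is known to have order n. *)
Definition balanced (n : nat) (w : word) : bool :=
  count negb w == count id w %[mod n].

Lemma count_negb_map (w : word) : count negb (map negb w) = count id w.
Proof. by rewrite count_map; apply: eq_count => b /=; rewrite negbK. Qed.

Lemma count_id_map (w : word) : count id (map negb w) = count negb w.
Proof. by rewrite count_map; apply: eq_count. Qed.

Lemma map_negbK (w : word) : map negb (map negb w) = w.
Proof. by apply: mapK => b; rewrite negbK. Qed.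

Lemma balanced_mapN (n : nat) (w : word) : balanced n (map negb w) = balanced n w.
Proof. by rewrite /balanced count_negb_map count_id_map eq_sym. Qed.

Lemma balanced_perm (n : nat) (w w' : word) :
  perm_eq w w' -> balanced n w = balanced n w'.
Proof. by move=> /seq.permP eqc; rewrite /balanced !eqc. Qed.

Lemma balanced_cat (n : nat) (w w' : word) :
  balanced n w -> balanced n w' -> balanced n (w ++ w').
Proof.
rewrite /balanced !count_cat => /eqP e1 /eqP e2.
by rewrite -modnDm e1 e2 modnDm.
Qed.

Lemma balanced_nseq (n m : nat) (b : bool) :
  balanced n (nseq m b) = (n %| m)%N.
Proof.
rewrite /balanced !count_nseq /dvdn -[in RHS](mod0n n).
by case: b; rewrite !(mul0n, mul1n) // eq_sym.
Qed.

Lemma balanced_cons_cancel (n : nat) (b : bool) (w : word) :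
  balanced n [:: ~~ b, b & w] = balanced n w.
Proof.
by case: b; rewrite /balanced /= !(add0n, addnA, add1n) -!(addn1 (count _ _)) eqn_modDr.
Qed.

Lemma rho_scalar_eq1 (n : nat) (w : word) : (1 < n)%N ->
  (xi n ^+ count negb w * (xi n)^-1 ^+ count id w == 1) = balanced n w.
Proof.
move=> n_gt1; have p := xi_prim n_gt1.
have x0 : xi n != 0 by rewrite (prim_root_eq0 p) -lt0n ltnW.
move: (xi n) p x0 => x p x0.
rewrite exprVn -[1]divr1 eqr_div ?expf_neq0 ?oner_eq0 // mulr1 mul1r.
exact: eq_prim_root_expr.
Qed.

(** The group elements with [k = 1], [e = false] and with [k = 0], [e = true] are rho and tau;
    conversely, what both fix is fixed by all their products. *)
Lemma dih_invariantP (n : nat) (f : fa) : (1 < n)%N ->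
  dih_invariant n f <->
  [/\ is_poly f, forall w, ~~ balanced n w -> f w = 0
    & forall w, f (map negb w) = f w].
Proof.
move=> n_gt1; split=> [[pf inv]|[pf supp tauf]]; split=> //.
- move=> w nb; have : rho_act n f w = f w := congr1 (fun g : fa => g w) (inv 1%N false).
  rewrite /rho_act => /eqP.
  rewrite -subr_eq0 -[X in _ - X]mul1r -mulrBl mulf_eq0 subr_eq0.
  by rewrite rho_scalar_eq1 // (negPf nb) => /eqP.
- move=> w; have : tau_act f w = f w := congr1 (fun g : fa => g w) (inv 0%N true).
  by [].
move=> k e; rewrite /dih_act; have -> : (if e then tau_act f else f) = f.
  by case: e => //; apply: functional_extensionality => w; exact: tauf.
elim: k => [//|k IHk]; rewrite iterS IHk.
apply: functional_extensionality => w; rewrite /rho_act.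
have [bw|nb] := boolP (balanced n w); last by rewrite supp // mulr0.
by move: bw; rewrite -rho_scalar_eq1 // => /eqP ->; rewrite mul1r.
Qed.

Lemma is_poly_add (f g : fa) : is_poly f -> is_poly g -> is_poly (fa_add f g).
Proof.
move=> [N fN] [M gM]; exists (N + M)%N => w le_w.
by rewrite /fa_add fN ?gM ?addr0 //; apply: leq_trans le_w; rewrite ?leq_addl ?leq_addr.
Qed.

Lemma is_poly_mul (f g : fa) : is_poly f -> is_poly g -> is_poly (fa_mul f g).
Proof.
move=> [N fN] [M gM]; exists (N + M)%N => w le_w; apply: big1 => i _.
have le_iw : (i <= size w)%N by rewrite -ltnS.
have [le_Ni|lt_iN] := leqP N i.
  by rewrite fN ?mul0r // size_takel.
rewrite (gM (drop i w)) ?mulr0 // size_drop leq_subRL // (leq_trans _ le_w) //.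
by rewrite leq_add2r ltnW.
Qed.

Lemma take_drop_balanced (n i : nat) (w : word) :
  balanced n (take i w) -> balanced n (drop i w) -> balanced n w.
Proof. by move=> b1 b2; rewrite -(cat_take_drop i w) balanced_cat. Qed.

(** * The position action on words, and the invariants as an S-subalgebra *)

Definition reindex_word (k : nat) (s : 'S_k) (w : word) : word :=
  [seq nth false w (s i) | i <- enum 'I_k].

(** The letters are read through [g] from a tuple over any type, so that a tuple of pairs can later
    carry two words moved by the same permutation. *)
Lemma reindex_word_tnth (T : Type) (k : nat) (s : 'S_k) (t : k.-tuple T)
    (g : T -> bool) :
  reindex_word s (map g t) = [seq g (tnth t (s i)) | i <- enum 'I_k].
Proof.
apply: eq_map => i; have x0 := tnth t i.
by rewrite (nth_map x0) ?size_tuple // -tnth_nth.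
Qed.

Lemma reindex_word_perm (k : nat) (s : 'S_k) (w : word) :
  size w = k -> perm_eq (reindex_word s w) w.
Proof.
move=> /eqP sz; have -> : w = Tuple sz by [].
apply/tuple_permP; exists s; rewrite /= -[X in reindex_word _ X]map_id.
by rewrite (reindex_word_tnth _ (Tuple sz) id).
Qed.

Lemma reindex_word_map (k : nat) (s : 'S_k) (g : bool -> bool) (w : word) :
  size w = k -> reindex_word s (map g w) = map g (reindex_word s w).
Proof.
move=> /eqP sz; have -> : w = Tuple sz by [].
rewrite reindex_word_tnth -[X in map g (_ _ X)]map_id.
by rewrite (reindex_word_tnth _ (Tuple sz) id) -map_comp.
Qed.

Lemma reindex_word_inj (k : nat) (s : 'S_k) (w w' : word) :
  size w = k -> size w' = k -> reindex_word s w = reindex_word s w' -> w = w'.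
Proof.
move=> sz sz' eqs; apply: (@eq_from_nth _ false); first by rewrite sz.
move=> i; rewrite sz => lt_ik.
move/eq_in_map: eqs => /(_ (s^-1 (Ordinal lt_ik))%g); rewrite permKV; apply.
exact: mem_enum.
Qed.

(** For the position action: permuting positions preserves the letter counts and commutes with
    exchanging u and v. *)
Lemma dih_invariant_S_subalgebra (n : nat) : (1 < n)%N ->
  is_S_subalgebra (dih_invariant n).
Proof.
move=> n_gt1; have dihP f := dih_invariantP f n_gt1.
split=> [f []//|].
split; first by apply/dihP; split=> //; exists 0%N.
split.
  apply/dihP; split; last by case.
    by exists 1%N; case.
  by case=> [|b w] //; rewrite /balanced eqxx.
split.
  move=> f g /dihP[pf sf tf] /dihP[pg sg tg]; apply/dihP; split.
  - exact: is_poly_add.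
  - by move=> w nb; rewrite /fa_add sf ?sg ?addr0.
  by move=> w; rewrite /fa_add tf tg.
split.
  move=> c f /dihP[[N fN] sf tf]; apply/dihP; split.
  - by exists N => w le_w; rewrite /fa_scale fN ?mulr0.
  - by move=> w nb; rewrite /fa_scale sf ?mulr0.
  by move=> w; rewrite /fa_scale tf.
split.
  move=> f g /dihP[pf sf tf] /dihP[pg sg tg]; apply/dihP; split.
  - exact: is_poly_mul.
  - move=> w nb; apply: big1 => i _.
    have [b1|/sf->] := boolP (balanced n (take i w)); last by rewrite mul0r.
    have [b2|/sg->] := boolP (balanced n (drop i w)); last by rewrite mulr0.
    by rewrite (take_drop_balanced b1 b2) in nb.
  move=> w; rewrite /fa_mul size_map; apply: eq_bigr => i _.
  by rewrite -map_take -map_drop tf tg.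
split.
  move=> k f /dihP[[N fN] sf tf]; apply/dihP; split.
  - by exists N => w le_w; rewrite /hcomp fN ?if_same.
  - by move=> w nb; rewrite /hcomp sf ?if_same.
  by move=> w; rewrite /hcomp size_map tf.
move=> k s f /dihP[pf sf tf] _; apply/dihP; split.
- by exists k.+1 => w lt_w; rewrite /posact gtn_eqF.
- move=> w nb; rewrite /posact; case: eqP => // sz; apply: sf.
  by rewrite (balanced_perm n (reindex_word_perm s sz)).
move=> w; rewrite /posact size_map; case: eqP => // sz.
by rewrite -!/(reindex_word s _) reindex_word_map.
Qed.

(** * Monomials and their orbit sums under tau *)

Definition mono (w : word) : fa := fun x => (x == w)%:R.

(** This is P w. The two monomials coincide only for the empty word, where the value is 2. *)
Definition sym_mono (w : word) : fa := fa_add (mono w) (mono (map negb w)).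

Lemma mono_mul (w w' : word) : fa_mul (mono w) (mono w') = mono (w ++ w').
Proof.
apply: functional_extensionality => x; rewrite /fa_mul /mono.
have [->|ne_x] := eqVneq x (w ++ w'); last first.
  apply: big1 => i _; case: eqP => [e1|]; last by rewrite mul0r.
  case: eqP => [e2|]; last by rewrite mulr0.
  by case/eqP: ne_x; rewrite -(cat_take_drop i x) e1 e2.
have lt_w : (size w < (size (w ++ w')).+1)%N by rewrite size_cat ltnS leq_addr.
rewrite (bigD1 (Ordinal lt_w)) // take_size_cat // drop_size_cat // !eqxx mulr1.
rewrite big1 => [|i ne_i]; first exact: addr0.
case: eqP => [/(congr1 size)|]; last by rewrite mul0r.
rewrite size_takel -1?ltnS // => eq_i; case/eqP: ne_i; exact: val_inj.
Qed.

Lemma fa_mulDl (f g h : fa) : fa_mul (fa_add f g) h = fa_add (fa_mul f h) (fa_mul g h).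
Proof.
apply: functional_extensionality => x; rewrite /fa_add /fa_mul -big_split.
by apply: eq_bigr => i _; rewrite mulrDl.
Qed.

Lemma fa_mulDr (f g h : fa) : fa_mul h (fa_add f g) = fa_add (fa_mul h f) (fa_mul h g).
Proof.
apply: functional_extensionality => x; rewrite /fa_add /fa_mul -big_split.
by apply: eq_bigr => i _; rewrite mulrDr.
Qed.

Lemma sym_mono_map (w : word) : sym_mono (map negb w) = sym_mono w.
Proof.
by rewrite /sym_mono map_negbK; apply: functional_extensionality => x; rewrite /fa_add addrC.
Qed.

Lemma sym_mono_mul (w w' : word) :
  fa_mul (sym_mono w) (sym_mono w') =
  fa_add (sym_mono (w ++ w')) (sym_mono (w ++ map negb w')).
Proof.
rewrite /sym_mono fa_mulDl !fa_mulDr !mono_mul !map_cat map_negbK.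
by apply: functional_extensionality => x; rewrite /fa_add [X in _ + X = _]addrC addrACA.
Qed.

Lemma gen1E : gen1 = sym_mono [:: false; true].
Proof. by rewrite /gen1 /fa_u /fa_v !(mono_mul [:: _] [:: _]). Qed.

Lemma fa_pow_var (b : bool) (m : nat) : fa_pow (fa_var b) m = mono (nseq m b).
Proof. by elim: m => //= m IHm; rewrite /fa_pow /= -/(fa_pow _ m) IHm (mono_mul [:: b]). Qed.

Lemma gen2E (n : nat) (b : bool) : gen2 n = sym_mono (nseq n b).
Proof.
suff E : gen2 n = sym_mono (nseq n false).
  by case: b => //; rewrite E -sym_mono_map map_nseq.
by rewrite /gen2 /fa_u /fa_v !fa_pow_var /sym_mono map_nseq.
Qed.

Lemma sym_mono_homog (w : word) : homog (size w) (sym_mono w).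
Proof.
move=> x ne_xw; rewrite /sym_mono /fa_add /mono.
have /negPf-> : x != w by apply: contraNneq ne_xw => ->.
have /negPf-> : x != map negb w by apply: contraNneq ne_xw => ->; rewrite size_map.
by rewrite addr0.
Qed.

Lemma sym_mono_invariant (n : nat) (w : word) : (1 < n)%N ->
  balanced n w -> dih_invariant n (sym_mono w).
Proof.
move=> n_gt1 bw; apply/dih_invariantP => //; split.
- exists (size w).+1 => x lt_wx; apply: sym_mono_homog; rewrite gtn_eqF //.
- move=> x nb; rewrite /sym_mono /fa_add /mono.
  have /negPf-> : x != w by apply: contraNneq nb => ->.
  have /negPf-> : x != map negb w by apply: contraNneq nb => ->; rewrite balanced_mapN.
  by rewrite addr0.
move=> x; rewrite /sym_mono /fa_add /mono addrC (inj_eq (inj_map negb_inj)).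
have <- // : (map negb x == w) = (x == map negb w).
by rewrite -{1}(map_negbK w) (inj_eq (inj_map negb_inj)).
Qed.

(** Reindexing by [s] is injective on words of length [k], so exactly one word is sent to the given
    one. *)
Lemma posact_mono (T : Type) (k : nat) (s : 'S_k) (t : k.-tuple T) (g : T -> bool) :
  posact s (mono [seq g (tnth t (s i)) | i <- enum 'I_k]) = mono (map g t).
Proof.
apply: functional_extensionality => x; rewrite /posact /mono.
rewrite -!/(reindex_word s _) -reindex_word_tnth; case: eqP => [sz|ne_sz].
  have sz_t : size (map g t) = k by rewrite size_map size_tuple.
  suff -> : (reindex_word s x == reindex_word s (map g t)) = (x == map g t) by [].
  by apply/eqP/eqP => [/(reindex_word_inj sz sz_t)|->].
by case: eqP => // x_t; case: ne_sz; rewrite x_t size_map size_tuple.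
Qed.

Lemma posact_add (k : nat) (s : 'S_k) (f g : fa) :
  posact s (fa_add f g) = fa_add (posact s f) (posact s g).
Proof.
by apply: functional_extensionality => x; rewrite /posact /fa_add; case: ifP; rewrite ?addr0.
Qed.

Lemma posact_sym_mono (T : Type) (k : nat) (s : 'S_k) (t : k.-tuple T) (g : T -> bool) :
  posact s (sym_mono [seq g (tnth t (s i)) | i <- enum 'I_k]) = sym_mono (map g t).
Proof.
rewrite /sym_mono posact_add posact_mono -[map negb (map g t)]map_comp.
by rewrite -(posact_mono s t (negb \o g)) -map_comp.
Qed.

Lemma homog_add (k : nat) (f g : fa) : homog k f -> homog k g -> homog k (fa_add f g).
Proof. by move=> hf hg w nw; rewrite /fa_add hf ?hg ?addr0. Qed.

(** * Closure rules for orbit sums in an S-subalgebra *)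

(** A list of pairs encodes two words of equal length. Permuting it applies one permutation of
    positions to both, and the position action is linear, so a sum can be moved even when its
    summands are not known to lie in [F]. *)
Lemma S_subalgebra_pair_perm (F : fa -> Prop) (z z' : seq (bool * bool)) :
  is_S_subalgebra F -> perm_eq z z' ->
  F (fa_add (sym_mono (unzip1 z)) (sym_mono (unzip2 z))) ->
  F (fa_add (sym_mono (unzip1 z')) (sym_mono (unzip2 z'))).
Proof.
move=> [_ [_ [_ [_ [_ [_ [_ Fpos]]]]]]] eq_z Fz.
have /tuple_permP[s Dz] : perm_eq z (in_tuple z') by [].
pose t := in_tuple z'; rewrite -/t in s Dz *.
have proj (g : bool * bool -> bool) :
    map g z = [seq g (tnth t (s i)) | i <- enum 'I_(size z')].
  by rewrite Dz /= -map_comp.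
have hom g : homog (size z') (sym_mono [seq g (tnth t (s i)) | i <- enum 'I_(size z')]).
  by have := @sym_mono_homog [seq g (tnth t (s i)) | i <- enum 'I_(size z')];
     rewrite size_map size_enum_ord.
move: Fz; rewrite /unzip1 /unzip2 !proj => /(Fpos _ s).
rewrite posact_add !posact_sym_mono; apply.
exact: homog_add.
Qed.

Lemma S_subalgebra_double (F : fa -> Prop) (f : fa) :
  is_S_subalgebra F -> F (fa_add f f) <-> F f.
Proof.
move=> [_ [_ [_ [Fadd [Fscale _]]]]]; split=> [/(Fscale 2^-1)|Ff]; last exact: Fadd.
congr F; apply: functional_extensionality => w; rewrite /fa_scale /fa_add.
by rewrite -mulr2n -(mulr_natl (f w) 2) mulKf // pnatr_eq0.
Qed.

Lemma S_subalgebra_addK (F : fa -> Prop) (f g : fa) :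
  is_S_subalgebra F -> F (fa_add f g) -> F g -> F f.
Proof.
move=> [_ [_ [_ [Fadd [Fscale _]]]]] Ffg /(Fscale (-1)) /(Fadd _ _ Ffg).
congr F; apply: functional_extensionality => w; rewrite /fa_scale /fa_add.
by rewrite mulN1r addrK.
Qed.

(** Pairing each letter with itself reduces this to the rule for pairs, up to a factor 2. *)
Lemma S_subalgebra_perm (F : fa -> Prop) (w w' : word) :
  is_S_subalgebra F -> perm_eq w w' -> F (sym_mono w) -> F (sym_mono w').
Proof.
move=> sF eq_w /(S_subalgebra_double _ sF) Fw; apply/(S_subalgebra_double _ sF).
have := @S_subalgebra_pair_perm F [seq (b, b) | b <- w] [seq (b, b) | b <- w'] sF.
rewrite /unzip1 /unzip2 -!map_comp !map_id; apply=> //.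
exact: perm_map.
Qed.

(* With [P = sym_mono] and [c = ~~ b], each of [P(cbbr)], [P(bcbr)], [P(bbcr)]
   is the opposite of the two others modulo [F]; going around this triangle
   shows [2 P(cbbr)] lies in [F]. *)
Lemma S_subalgebra_triangle (F : fa -> Prop) (b : bool) (r : word) :
  is_S_subalgebra F -> F gen1 ->
  F (sym_mono (b :: r)) -> F (sym_mono [:: ~~ b, b, b & r]).
Proof.
move=> sF F1 Fbr; have [_ [_ [_ [Fadd [_ [Fmul _]]]]]] := sF.
pose pair z := fa_add (sym_mono (unzip1 z)) (sym_mono (unzip2 z)).
have unzip_r : (unzip1 [seq (x, x) | x <- r] = r) * (unzip2 [seq (x, x) | x <- r] = r).
  by split; rewrite /unzip1 /unzip2 -map_comp map_id.
have gen1b : gen1 = sym_mono [:: ~~ b; b].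
  by rewrite gen1E; case: b {Fbr} => //; rewrite -sym_mono_map.
(* The product of [gen1] and P(br) is P(cbbr) plus a term whose word ends in the exchanged [r];
   applying tau to that word turns it into bcbr. *)
have F12 : F (pair [:: (~~ b, b), (b, ~~ b), (b, b) & [seq (x, x) | x <- r]]).
  have := Fmul _ _ F1 Fbr; rewrite gen1b sym_mono_mul.
  rewrite -(sym_mono_map (_ ++ map negb _)) map_cat map_negbK /= negbK.
  by rewrite /pair /= !unzip_r.
have F13 : F (pair [:: (~~ b, b), (b, b), (b, ~~ b) & [seq (x, x) | x <- r]]).
  apply: S_subalgebra_pair_perm F12 => //.
  rewrite perm_cons; apply/permPl.
  exact: (perm_catCA [:: (b, ~~ b)] [:: (b, b)]).
have F23 : F (pair [:: (b, b), (b, ~~ b), (~~ b, b) & [seq (x, x) | x <- r]]).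
  apply: S_subalgebra_pair_perm F13 => //.
  by apply/permPl; exact: (perm_catCA [:: (~~ b, b)] [:: (b, b); (b, ~~ b)]).
(* [F12] plus [F13] minus [F23] leaves twice P(cbbr). *)
apply/(S_subalgebra_double _ sF); apply: (S_subalgebra_addK sF) F23.
move: (Fadd _ _ F12 F13); rewrite /pair /= !unzip_r.
congr F; apply: functional_extensionality => w; rewrite /fa_add.
by rewrite addrACA [X in _ + X = _]addrC.
Qed.

(** * Balanced orbit sums by induction on length *)

(** Once one u and one v are set aside, a letter remains; it repeats one of the two and is taken as
    [b]. *)
Lemma mixed_word_perm (w : word) :
  true \in w -> false \in w -> (2 < size w)%N ->
  exists b r, perm_eq w [:: ~~ b, b, b & r].
Proof.
move=> /perm_to_rem w_t w_f; have : false \in rem true w.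
  by move: w_f; rewrite (perm_mem w_t) inE.
move/perm_to_rem; set r := rem false _ => w_tf.
have {w_t w_tf} : perm_eq w [:: true, false & r].
  by rewrite (perm_trans w_t) // perm_cons.
case: r => [|[] r] w_p sz; first by rewrite (perm_size w_p) in sz.
  exists true, r; apply: (perm_trans w_p).
  by apply/permPl; exact: (perm_catCA [:: true] [:: false; true]).
by exists false, r.
Qed.

Lemma S_subalgebra_sym_mono (F : fa -> Prop) (n : nat) (w : word) :
  (2 < n)%N -> is_S_subalgebra F -> F gen1 -> F (gen2 n) ->
  balanced n w -> F (sym_mono w).
Proof.
move=> n_gt2 sF F1 F2; have [_ [_ [Fone [Fadd [Fscale [Fmul _]]]]]] := sF.
have n_gt0 : (0 < n)%N by exact: leq_trans n_gt2.
have [m] := ubnP (size w); elim: m w => // m IHm w; rewrite ltnS => le_wm bw.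
(* Stated for every mixed [x] of length at most [m], because the case of a power also needs it for
   another word as long as [w]. *)
have mixed x : (size x <= m)%N -> balanced n x -> true \in x -> false \in x ->
    (2 < size x)%N -> F (sym_mono x).
  move=> le_xm bx x_t x_f x_gt2; have [b [r x_p]] := mixed_word_perm x_t x_f x_gt2.
  apply: (S_subalgebra_perm sF) (S_subalgebra_triangle sF F1 _).
    by rewrite perm_sym; exact: x_p.
  apply: IHm; last by rewrite (balanced_perm n x_p) balanced_cons_cancel in bx.
  by apply: leq_trans le_xm; rewrite (perm_size x_p) /=.
have [/andP[w_t w_f]|] := boolP ((true \in w) && (false \in w)).
  have [w_gt2|w_le2] := ltnP 2 (size w); first exact: mixed.
  apply: (S_subalgebra_perm sF (w := [:: false; true])); last by rewrite -gen1E.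
  by move: w w_t w_f w_le2 {le_wm bw} => [|[] [|[] [|? ?]]].
rewrite negb_and => w_cst.
have {w_cst} [b Dw] : exists b, w = nseq (size w) b.
  case/orP: w_cst => w_b; [exists false | exists true]; apply/all_pred1P/allP => x.
    by case: x => // /(negP w_b).
  by case: x => // /(negP w_b).
move: bw le_wm; rewrite {}Dw; set l := size w; rewrite balanced_nseq size_nseq.
have [->|l_gt0] := posnP l.
  by move=> _ _; apply: (Fadd _ _ Fone Fone).
(* The length is a multiple of n: the multiple 0 is excluded, n itself gives [gen2], and a larger
   one splits off a factor of length n. *)
case/dvdnP => [[|[|q]]] Dl; first by rewrite Dl in l_gt0.
  by move=> _; rewrite Dl mul1n -gen2E.
move=> le_lm; have {}Dl : l = (q.+1 * n + n)%N by rewrite Dl mulSn addnC.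
have q_gt0 : (0 < q.+1 * n)%N by rewrite muln_gt0.
have Fq : F (sym_mono (nseq (q.+1 * n) b)).
  apply: IHm; last by rewrite balanced_nseq dvdn_mull.
  rewrite size_nseq; apply: leq_trans le_lm.
  by rewrite Dl -[X in (X < _)%N]addn0 ltn_add2l.
have := Fmul _ _ Fq F2; rewrite (gen2E n b) sym_mono_mul -nseqD -Dl.
move=> Fsum; apply: (S_subalgebra_addK sF Fsum).
apply: mixed; rewrite ?map_nseq.
- by rewrite size_cat !size_nseq -Dl.
- by rewrite balanced_cat // balanced_nseq // dvdn_mull.
- by rewrite mem_cat !mem_nseq q_gt0 n_gt0; case: b {Fq Fsum}.
- by rewrite mem_cat !mem_nseq q_gt0 n_gt0; case: b {Fq Fsum}.
by rewrite size_cat !size_nseq (leq_trans n_gt2) // leq_addl.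
Qed.

(** * Decomposition of invariants into orbit sums, and the conclusion *)

Lemma S_subalgebra_sum (F : fa -> Prop) (I : Type) (r : seq I) (g : I -> fa) :
  is_S_subalgebra F -> (forall i, F (g i)) -> F (fun w => \sum_(i <- r) g i w).
Proof.
move=> [_ [F0 [_ [Fadd _]]]] Fg; elim: r => [|i r IHr].
  by move: F0; congr F; apply: functional_extensionality => w; rewrite big_nil.
move: (Fadd _ _ (Fg i) IHr); congr F; apply: functional_extensionality => w.
by rewrite big_cons.
Qed.

Lemma poly_hcomp_sum (f : fa) (N : nat) :
  (forall w, (N <= size w)%N -> f w = 0) ->
  f = (fun w => \sum_(k <- iota 0 N) hcomp k f w).
Proof.
move=> fN; apply: functional_extensionality => w.
have [lt_wN|le_Nw] := ltnP (size w) N; last first.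
  by rewrite big1 ?fN // => k _; rewrite /hcomp fN ?if_same.
have hw : hcomp (size w) f w = f w by rewrite /hcomp eqxx.
rewrite (bigD1_seq (size w)) ?iota_uniq ?mem_iota // hw.
rewrite big1 => [|k]; first exact/esym/addr0.
by rewrite /hcomp eq_sym => /negPf->.
Qed.

Lemma sum_mul_delta (I : finType) (g : I -> C) (i0 : I) (P : I -> bool) :
  (forall i, P i = (i == i0)) -> \sum_i g i * (P i)%:R = g i0.
Proof.
move=> PE; rewrite (eq_bigr (fun i => if i == i0 then g i else 0)).
  by rewrite -big_mkcond big_pred1_eq.
by move=> i _; rewrite PE; case: eqP; rewrite ?mulr1 ?mulr0.
Qed.

(** The coefficient at [w] receives one half from the tuple [w] and one half from the tuple
    [map negb w], where [f] takes the same value. *)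
Lemma hcomp_sym_mono_sum (f : fa) (k : nat) :
  (forall w, f (map negb w) = f w) ->
  hcomp k f = (fun w => \sum_(t : k.-tuple bool)
                 fa_scale (f t / 2) (sym_mono t) w).
Proof.
move=> tauf; apply: functional_extensionality => w.
rewrite /hcomp; case: eqP => [/eqP sz|ne_sz]; last first.
  rewrite big1 // => t _; rewrite /fa_scale (sym_mono_homog (w := t)) ?mulr0 //.
  by rewrite size_tuple; apply/eqP.
have szN : size (map negb w) == k by rewrite size_map.
rewrite (eq_bigr (fun t : k.-tuple bool => f t / 2 * (w == t)%:R
    + f t / 2 * (w == map negb t)%:R)); last first.
  by move=> t _; rewrite -mulrDr.
rewrite big_split (@sum_mul_delta _ _ (Tuple sz)); last by move=> t; rewrite eq_sym.
rewrite (@sum_mul_delta _ _ (Tuple szN)); last first.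
  move=> t; rewrite -val_eqE /= -{1}(map_negbK w) eq_sym.
  exact: (inj_eq (inj_map negb_inj)).
have half x : x / 2 + x / 2 = x :> C by rewrite -splitr.
by rewrite /= tauf; exact/esym/half.
Qed.

Theorem mainTheorem3 (n : nat) : (3 <= n)%N ->
  forall f : fa,
    S_generated (fun g => g = gen1 \/ g = gen2 n) f <-> dih_invariant n f.
Proof.
move=> n_gt2 f; have n_gt1 : (1 < n)%N := ltnW n_gt2; split=> [gen|inv].
  apply: gen => [|g [->|->]]; first exact: dih_invariant_S_subalgebra.
    by rewrite gen1E; apply: sym_mono_invariant; rewrite // /balanced eqxx.
  by rewrite (gen2E n false); apply: sym_mono_invariant; rewrite ?balanced_nseq.
move=> F sF genF; have F1 : F gen1 by apply: genF; left.
have F2 : F (gen2 n) by apply: genF; right.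
have [[N fN] supp tauf] := (dih_invariantP f n_gt1).1 inv.
have [_ [F0 [_ [_ [Fscale _]]]]] := sF.
rewrite (poly_hcomp_sum fN); apply: S_subalgebra_sum => // k.
rewrite hcomp_sym_mono_sum //; apply: S_subalgebra_sum => // t.
have [bt|nb] := boolP (balanced n t).
  exact: Fscale (S_subalgebra_sym_mono n_gt2 sF F1 F2 bt).
(* An unbalanced word has coefficient 0 in [f], so its term is the zero element. *)
move: F0; congr F; apply: functional_extensionality => w.
by rewrite /fa_scale supp // mul0r mul0r.
Qed.
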